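(* Let $\Bbbk$ be an algebraically closed field of characteristic zero and let $D=\mathcal{M}^*(d,\Bbbk)$ be the simple coalgebra of dimension $d^2$. (i) Let $f$ be a coalgebra automorphism of $D$ of finite order $n$. Then there exist a multiplicative matrix $\mathbf{e}=(e_{ij})_{1\le i,j\le d}$ for $D$ and $\omega_1,\ldots,\omega_d\in\Bbbk^\times$ such that $f(e_{ij})=\omega_i\omega_j^{-1}e_{ij}$ for all $i,j$, and all $\omega_i\omega_j^{-1}$ are $n$-th roots of unity. (ii) Let $f$ be a coalgebra anti-automorphism of $D$ with $1<n=\operatorname{ord}(f^2)<\infty$. Then there exist a multiplicative matrix $\mathbf{e}$ for $D$, a symmetric matrix $A_+\in \mathrm{GL}(\Bbbk,a_+)$, an anti-symmetric matrix $A_-\in\mathrm{GL}(\Bbbk,a_-)$, and $A_j\in\mathrm{GL}(\Bbbk,a_j)$, $\lambda_j\in\Bbbk^\times$ for $j=1,\ldots,s$, such that $d=a_++a_-+2a_1+\cdots+2a_s$ and the matrix $A$ of $f$ corresponding to $\mathbf{e}$ is the following block matrix, with successive row (and column) block sizes $a_1,\ldots,a_s,a_+,a_-,a_s,\ldots,a_1$: in the $j$-th block row ($1\le j\le s$) the only nonzero block is $\lambda_jA_j^t$, placed in the $j$-th block column counted from the right; in the two middle block rows (sizes $a_+$, $a_-$) the only nonzero blocks are $A_+$ and $A_-$, respectively, placed on the diagonal; in the $j$-th block row counted from the bottom ($1\le j\le s$) the only nonzero block is $A_j$, placed in the $j$-th block column. That is, $$A=\begin{bmatrix} 0&\cdots&0&0&0&0&\cdots&\lambda_1A_1^t\\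 \vdots& & & & & & &\vdots\\ 0&\cdots&0&0&0&\lambda_sA_s^t&\cdots&0\\ 0&\cdots&0&A_+&0&0&\cdots&0\\ 0&\cdots&0&0&A_-&0&\cdots&0\\ 0&\cdots&A_s&0&0&0&\cdots&0\\ \vdots& & & & & & &\vdots\\ A_1&\cdots&0&0&0&0&\cdots&0 \end{bmatrix}.$$ Moreover: (a) $\lambda_i^2$, $\lambda_i\lambda_j^{-1}$ and $\lambda_i\lambda_j$ are $n$-th roots of unity; (b) if $a_+\ne0$ then the $\lambda_i$ are $n$-th roots of unity; (c) if $a_-\neq0$ then the $-\lambda_i$ are $n$-th roots of unity. In particular, if $f$ is as in (ii), $d=3$ and $n>2$, then there are a multiplicative matrix $\mathbf{e}$ for $D$ and $\lambda\in\Bbbk^\times$ such that the matrix of $f$ corresponding to $\mathbf{e}$ is $$A_\lambda=\begin{bmatrix}0&0&\lambda\\0&1&0\\1&0&0\end{bmatrix},\qquad f(\mathbf{e})=\begin{bmatrix} e_{33}&\lambda e_{23}&\lambda e_{13}\\ \lambda^{-1}e_{32}&e_{22}&e_{12}\\ \lambda^{-1}e_{31}&e_{21}&e_{11}\end{bmatrix}\quad\text{and}\quad f^2(e_{ij})=\lambda^{j-i}e_{ij}.$$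
   Context: $\mathcal{M}^*(d,\Bbbk)$ is the coalgebra dual to the matrix algebra $\mathcal{M}(d,\Bbbk)$. A multiplicative matrix for $D=\mathcal{M}^*(d,\Bbbk)$ is a basis $\mathbf{e}=(e_{ij})_{1\le i,j\le d}$ of $D$ with $\Delta(e_{ij})=\sum_{\ell}e_{i\ell}\otimes e_{\ell j}$ and $\varepsilon(e_{ij})=\delta_{ij}$, regarded as a $d\times d$ matrix with entries in $D$. For a linear map $f$, $f(\mathbf{e})$ denotes the matrix $(f(e_{ij}))_{i,j}$. The matrix of a coalgebra automorphism $f$ corresponding to $\mathbf{e}$ is an invertible matrix $B$ (unique up to a scalar) with $f(\mathbf{e})=B\,\mathbf{e}\,B^{-1}$; the matrix of a coalgebra anti-automorphism $f$ corresponding to $\mathbf{e}$ is an invertible matrix $A$ (unique up to a scalar) with $f(\mathbf{e})=A\,\mathbf{e}^t\,A^{-1}$. The numbers $a_\pm$, $s$ may be zero (the corresponding blocks are then absent). $\mathrm{GL}(\Bbbk,a)$ is the group of invertible $a\times a$ matrices over $\Bbbk$. *)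

(* Defs.v *)
From HB Require Import structures.
From mathcomp Require Import all_boot all_order all_algebra.

Set Implicit Arguments.
Unset Strict Implicit.
Unset Printing Implicit Defensive.

Import GRing.Theory.
Import VectorInternalTheory.
Local Open Scope ring_scope.

Section Tensor.
Variable K : fieldType.

(* The entry (i, j) of a tensor is its coordinate on e_i (x) f_j, where
   e_i = r2v (delta_mx 0 i) and f_j = r2v (delta_mx 0 j) are the coordinate
   bases of U and V.  Lemmas tens_linear_l, tens_linear_r,
   tensor_lift_linear, tensor_liftE and tensor_lift_uniq give the universal property, which makes the notion
   independent of these bases. *)
Definition tensor (U V : vectType K) : vectType K :=
  'M[K]_(dim U, dim V).

Definition tens (U V : vectType K) (u : U) (v : V) : tensor U V :=
  (v2r u)^T *m v2r v.

Definition tensor_lift (U V W : vectType K) (h : U -> V -> W)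
    (T : tensor U V) : W :=
  \sum_(i < dim U) \sum_(j < dim V)
     T i j *: h (r2v (delta_mx 0 i)) (r2v (delta_mx 0 j)).

Definition tensor_map (U V U' V' : vectType K) (f : U -> U') (g : V -> V') :
    tensor U V -> tensor U' V' :=
  tensor_lift (fun u v => tens (f u) (g v)).

Definition tensor_swap (U V : vectType K) : tensor U V -> tensor V U :=
  tensor_lift (fun u v => tens v u).

End Tensor.

Notation "u \ox v" := (tens u v) (at level 40, left associativity).

Section TensorTheory.
Variable K : fieldType.
Implicit Types U V W : vectType K.

Lemma tensE U V (u : U) (v : V) i j : (u \ox v) i j = v2r u 0 i * v2r v 0 j.
Proof. by rewrite mxE big_ord1 mxE. Qed.

Lemma tens_linear_l U V (v : V) : linear (fun u : U => u \ox v).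
Proof.
by move=> a u u'; apply/matrixP => i j; rewrite !(tensE, mxE) linearP !mxE
   mulrDl mulrA.
Qed.

Lemma tens_linear_r U V (u : U) : linear (fun v : V => u \ox v).
Proof.
by move=> a v v'; apply/matrixP => i j; rewrite !(tensE, mxE) linearP !mxE
   mulrDr mulrCA.
Qed.

Lemma tensor_lift_linear U V W (h : U -> V -> W) : linear (tensor_lift h).
Proof.
move=> a S T; rewrite /tensor_lift scaler_sumr -big_split; apply: eq_bigr => i _ /=.
rewrite scaler_sumr -big_split; apply: eq_bigr => j _ /=.
by rewrite !mxE scalerDl scalerA.
Qed.

Lemma linearZ_fun U W (h : U -> W) (hlin : linear h) (c : K) x :
  h (c *: x) = c *: h x.
Proof.
pose hL := GRing.isLinear.Build K U W *:%R h hlin.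
pose h' : {linear U -> W} := HB.pack h hL.
by rewrite -[h]/(h' : U -> W) linearZ.
Qed.

Lemma linear_sum_fun U W (h : U -> W) (hlin : linear h) (I : finType)
    (x : I -> U) :
  h (\sum_i x i) = \sum_i h (x i).
Proof.
pose hL := GRing.isLinear.Build K U W *:%R h hlin.
pose h' : {linear U -> W} := HB.pack h hL.
by rewrite -[h]/(h' : U -> W) linear_sum.
Qed.

Lemma linear_comb_fun U W (h : U -> W) (hlin : linear h) (I : finType)
    (c : I -> K) (x : I -> U) :
  h (\sum_i c i *: x i) = \sum_i c i *: h (x i).
Proof.
by rewrite (linear_sum_fun hlin); apply: eq_bigr => i _; rewrite linearZ_fun.
Qed.

Lemma r2v_coord U (u : U) :
  u = \sum_(i < dim U) v2r u 0 i *: r2v (delta_mx 0 i).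
Proof.
rewrite -[LHS]v2rK [v2r u in LHS]row_sum_delta linear_sum.
by apply: eq_bigr => i _; rewrite linearZ.
Qed.

Lemma tensor_liftE U V W (h : U -> V -> W) :
  (forall v, linear (h^~ v)) -> (forall u, linear (h u)) ->
  forall u v, tensor_lift h (u \ox v) = h u v.
Proof.
move=> hl hr u v; rewrite [u in RHS]r2v_coord (linear_comb_fun (hl v)).
apply: eq_bigr => i _; rewrite [v in RHS]r2v_coord (linear_comb_fun (hr _)).
by rewrite scaler_sumr; apply: eq_bigr => j _; rewrite tensE scalerA.
Qed.

Lemma tensor_span U V (T : tensor U V) :
  T = tensor_lift (fun u v => u \ox v) T.
Proof.
rewrite {1}[T]matrix_sum_delta; apply: eq_bigr => i _; apply: eq_bigr => j _.
congr (_ *: _); apply/matrixP => a b.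
by rewrite tensE !r2vK !mxE !eqxx /= -natrM mulnb.
Qed.

Lemma tensor_lift_uniq U V W (g h : tensor U V -> W) :
  linear g -> linear h -> (forall u v, g (u \ox v) = h (u \ox v)) -> g =1 h.
Proof.
move=> gl hl gh T; rewrite [T]tensor_span /tensor_lift !pair_big /=.
rewrite (linear_comb_fun gl (fun p => T p.1 p.2)).
rewrite (linear_comb_fun hl (fun p => T p.1 p.2)).
by apply: eq_bigr => p _; rewrite gh.
Qed.

Lemma tensor_mapE U V U' V' (f : 'Hom(U, U')) (g : 'Hom(V, V')) u v :
  tensor_map f g (u \ox v) = f u \ox g v.
Proof.
apply: tensor_liftE => [{}v|{}u] a x y; rewrite linearP.
  exact: tens_linear_l.
exact: tens_linear_r.
Qed.

Lemma tensor_swapE U V (u : U) (v : V) : tensor_swap (u \ox v) = v \ox u.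
Proof. exact: (tensor_liftE (@tens_linear_r _ _) (@tens_linear_l _ _)). Qed.

End TensorTheory.

Section MatrixCoalgebra.
Variables (K : fieldType) (d : nat).

Definition mxcoalg : vectType K := 'Hom('M[K]_d, K^o).

Definition mxcoord (i j : 'I_d) : mxcoalg :=
  linfun (fun A : 'M[K]_d => A i j : K^o).

(* The transpose of the multiplication of 'M[K]_d under the identification of
   ('M (x) 'M)^* with mxcoalg (x) mxcoalg; see comulP. *)
Definition comul (phi : mxcoalg) : tensor mxcoalg mxcoalg :=
  \sum_i \sum_j \sum_k \sum_l
    (phi (delta_mx i j *m delta_mx k l) : K) *: (mxcoord i j \ox mxcoord k l).

Definition counit (phi : mxcoalg) : K := phi 1%:M.

Definition tensor_eval (x y : 'M[K]_d) : tensor mxcoalg mxcoalg -> K^o :=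
  tensor_lift (fun phi psi : mxcoalg => (phi x : K) * (psi y : K) : K^o).

Lemma mxcoordE i j A : mxcoord i j A = A i j.
Proof.
have lin : linear (fun A : 'M[K]_d => A i j : K^o) by move=> a B C; rewrite !mxE.
pose hL := GRing.isLinear.Build K 'M[K]_d K^o *:%R _ lin.
pose h : {linear 'M[K]_d -> K^o} := HB.pack (fun A : 'M[K]_d => A i j : K^o) hL.
exact: (lfunE h).
Qed.

Lemma tensor_evalE x y (phi psi : mxcoalg) :
  tensor_eval x y (phi \ox psi) = (phi x : K) * (psi y : K).
Proof.
apply: tensor_liftE => [{}psi|{}phi] a u v; rewrite !lfunE /= lfunE.
  by rewrite mulrDl scalerAl.
by rewrite mulrDr scalerAr.
Qed.

Lemma mxcoord_span (phi : mxcoalg) :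
  phi = \sum_i \sum_j (phi (delta_mx i j) : K) *: mxcoord i j.
Proof.
apply/lfunP => A; rewrite {1}[A]matrix_sum_delta linear_sum sum_lfunE.
apply: eq_bigr => i _; rewrite linear_sum sum_lfunE; apply: eq_bigr => j _.
by rewrite linearZ lfunE /= mxcoordE; apply: mulrC.
Qed.

Lemma comulP (phi : mxcoalg) x y : tensor_eval x y (comul phi) = phi (x *m y).
Proof.
have el : linear (tensor_eval x y) by exact: tensor_lift_linear.
pose hL := GRing.isLinear.Build K _ K^o *:%R (tensor_eval x y) el.
pose h : {linear tensor mxcoalg mxcoalg -> K^o} := HB.pack (tensor_eval x y) hL.
rewrite -[tensor_eval x y]/(h : _ -> _) /comul.
rewrite [x in RHS]matrix_sum_delta mulmx_suml [RHS]linear_sum [LHS]linear_sum.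
apply: eq_bigr => i _; rewrite mulmx_suml [RHS]linear_sum [LHS]linear_sum.
apply: eq_bigr => j _; rewrite [y in RHS]matrix_sum_delta mulmx_sumr.
rewrite [RHS]linear_sum [LHS]linear_sum; apply: eq_bigr => k _.
rewrite mulmx_sumr [RHS]linear_sum [LHS]linear_sum; apply: eq_bigr => l _.
rewrite -[LHS]/(tensor_eval x y _) (linearZ_fun el) tensor_evalE !mxcoordE.
rewrite -scalemxAl -scalemxAr !linearZ /=.
by congr (_ * _); apply: mulrC.
Qed.

Lemma tensor_eval_inj (S T : tensor mxcoalg mxcoalg) :
  (forall x y, tensor_eval x y S = tensor_eval x y T) -> S = T.
Proof.
pose rebuild (T : tensor mxcoalg mxcoalg) := \sum_i \sum_j \sum_k \sum_l
  (tensor_eval (delta_mx i j) (delta_mx k l) T : K)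
    *: (mxcoord i j \ox mxcoord k l).
suff rebuildK : rebuild =1 id.
  move=> eqST; rewrite -[S]rebuildK -[T]rebuildK /rebuild.
  by do 4![apply: eq_bigr => ? _]; rewrite eqST.
apply: tensor_lift_uniq => [a {}S {}T|//|u v].
  rewrite /rebuild.
  do 4![rewrite scaler_sumr -big_split; apply: eq_bigr => ? _ /=].
  by rewrite scalerA -scalerDl; congr (_ *: _); exact: (@tensor_lift_linear K mxcoalg mxcoalg K^o).
rewrite [u in RHS]mxcoord_span /rebuild.
pose f (v : mxcoalg) (u : mxcoalg) := u \ox v; pose g (u v : mxcoalg) := u \ox v.
have fl w := @tens_linear_l K mxcoalg mxcoalg w : linear (f w).
have gl w := @tens_linear_r K mxcoalg mxcoalg w : linear (g w).
rewrite -[RHS]/(f v _) (linear_sum_fun (fl v)); apply: eq_bigr => i _.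
rewrite (linear_sum_fun (fl v)); apply: eq_bigr => j _.
rewrite (linearZ_fun (fl v)) [v in RHS]mxcoord_span -[f _ _]/(g _ _).
rewrite (linear_sum_fun (gl _)) scaler_sumr; apply: eq_bigr => k _.
rewrite (linear_sum_fun (gl _)) scaler_sumr; apply: eq_bigr => l _.
by rewrite (linearZ_fun (gl _)) scalerA tensor_evalE.
Qed.

Definition coalg_aut (f : 'End(mxcoalg)) : Prop :=
  [/\ bijective f,
      forall c, comul (f c) = tensor_map f f (comul c)
    & forall c, counit (f c) = counit c].

Definition coalg_antiaut (f : 'End(mxcoalg)) : Prop :=
  [/\ bijective f,
      forall c, comul (f c) = tensor_swap (tensor_map f f (comul c))
    & forall c, counit (f c) = counit c].

Definition multiplicative_mx (e : 'M[mxcoalg]_d) : Prop :=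
  [/\ basis_of fullv [seq e p.1 p.2 | p : 'I_d * 'I_d],
      forall i j, comul (e i j) = \sum_l (e i l \ox e l j)
    & forall i j, counit (e i j) = (i == j)%:R].

(* The product B e C of a matrix e over mxcoalg by two scalar matrices. *)
Definition mx_lrscale (B C : 'M[K]_d) (e : 'M[mxcoalg]_d) : 'M[mxcoalg]_d :=
  \matrix_(i, j) \sum_k \sum_l (B i k * C l j) *: e k l.

Definition antiaut_mx (f : 'End(mxcoalg)) (e : 'M[mxcoalg]_d) (A : 'M[K]_d) :
    Prop :=
  A \in unitmx /\ map_mx f e = mx_lrscale A (invmx A) e^T.

Lemma mxcoord_multiplicative : multiplicative_mx (\matrix_(i, j) mxcoord i j).
Proof.
split=> [|i j|i j]; last by rewrite mxE /counit mxcoordE mxE.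
  rewrite basisEdim; apply/andP; split; last first.
    rewrite size_map -cardE card_prod card_ord dimvf.
    by rewrite /dim /= muln1.
  apply/subvP => phi _; rewrite [phi]mxcoord_span.
  apply: rpred_sum => i _; apply: rpred_sum => j _; apply/rpredZ/memv_span.
  by apply/imageP; exists (i, j); rewrite ?mxE.
rewrite mxE; apply: tensor_eval_inj => x y.
have el : linear (tensor_eval x y) by exact: tensor_lift_linear.
rewrite comulP mxcoordE mxE (linear_sum_fun el); apply: eq_bigr => l _.
by rewrite !mxE tensor_evalE !mxcoordE.
Qed.

End MatrixCoalgebra.

Definition has_order (T : Type) (f : T -> T) (n : nat) : Prop :=
  [/\ (0 < n)%N, iter n f =1 id
    & forall m, (0 < m < n)%N -> ~ (iter m f =1 id)].

Section AntiBlock.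
Variable K : fieldType.

Fixpoint antiblock_dim (m s : nat) : ('I_s -> nat) -> nat :=
  match s with
  | 0 => fun=> m
  | s'.+1 => fun a =>
      (a ord0 + (antiblock_dim m (fun j => a (lift ord0 j)) + a ord0))%N
  end.

(*              [    0             0           lam_0 A_0^t ]
     one step:  [    0     antiblock_mx ...       0        ]
                [   A_0            0              0        ]
   where the inner matrix is built from the families shifted by one. *)
Fixpoint antiblock_mx (m : nat) (M : 'M[K]_m) (s : nat) :
    forall (a : 'I_s -> nat) (lam : 'I_s -> K) (A : forall j, 'M[K]_(a j)),
    'M[K]_(antiblock_dim m a) :=
  match s with
  | 0 => fun _ _ _ => M
  | s'.+1 => fun a lam A =>
      block_mx 0 (row_mx 0 (lam ord0 *: (A ord0)^T))
               (col_mx 0 (A ord0))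
               (block_mx (antiblock_mx M (fun j => lam (lift ord0 j))
                                         (fun j => A (lift ord0 j))) 0
                         0 0)
  end.

Lemma antiblock_dimE m s (a : 'I_s -> nat) :
  antiblock_dim m a = (m + 2 * \sum_(j < s) a j)%N.
Proof.
elim: s a => [|s IH] a /=; first by rewrite big_ord0 muln0 addn0.
by rewrite IH big_ord_recl mulnDr (mul2n (a _)) -addnn [LHS]addnCA [LHS]addnAC [RHS]addnA.
Qed.

(* The whole matrix, with successive block sizes
   a_0, ..., a_(s-1), ap, am, a_(s-1), ..., a_0. *)
Definition antiaut_block_mx (d ap am s : nat) (a : 'I_s -> nat)
    (Hd : d = (ap + am + 2 * \sum_(j < s) a j)%N)
    (Ap : 'M[K]_ap) (Am : 'M[K]_am)
    (lam : 'I_s -> K) (A : forall j, 'M[K]_(a j)) : 'M[K]_d :=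
  let eq_d := etrans (antiblock_dimE (ap + am) a) (esym Hd) in
  castmx (eq_d, eq_d) (antiblock_mx (block_mx Ap 0 0 Am) lam A).

End AntiBlock.

Definition mx33 (T : nmodType) (rows : seq (seq T)) : 'M[T]_3 :=
  \matrix_(i < 3, j < 3) (nth [::] rows i)`_j.

(* Main.v *)
From HB Require Import structures.
Require Import Defs.
From mathcomp Require Import all_boot all_order all_algebra.
From mathcomp Require Import perm separable cyclotomic zify.

(* The transpose of a coalgebra (anti-)automorphism of M^*(d, K) is an
   (anti-)automorphism of the matrix algebra, so by Skolem-Noether it is
   X |-> B X B^-1, respectively X |-> A X^T A^-1.

   (i) If the order is n, then B^n is central, so B is annihilated by a
   separable polynomial, hence diagonalizable, and a basis of eigenvectors gives
   the multiplicative matrix.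

   (ii) Here f^2 corresponds to B = A A^-T, which is diagonalizable with
   eigenvalues D_i by (i).  Changing basis by P turns A into P A P^T, so A is a
   bilinear form; in an eigenbasis of B it satisfies A = D A^T, that is
   A_ij = D_i A_ji = D_i D_j A_ij.  So A pairs the D_i-eigenspace of B only with
   the one of 1 / D_i.  As long as some D_i is not 1 or -1, split off a
   hyperbolic pair of eigenvectors for D_i and 1 / D_i, which contributes
   lambda = D_i; what remains is symmetric on the eigenvalue 1, antisymmetric on
   -1, and the two are orthogonal.  The root of unity conditions say
   (D_i / D_j)^n = 1.

   For d = 3 and n > 2 some pair must split off, and the remaining 1 x 1 block
   cannot be antisymmetric; it is normalised to 1 by a square root. *)

Set Implicit Arguments.
Unset Strict Implicit.
Unset Printing Implicit Defensive.

Import GRing.Theory.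
Local Open Scope ring_scope.

(** * Inner automorphisms of the matrix algebra and its centre *)

(* Row [i] of [P] is row [k] of [phi (delta_mx 0 i)], where row [k] of
   [phi (delta_mx 0 0)] is nonzero; then [P *m phi X = X *m P] holds entirely
   formally, and simplicity of the matrix algebra makes [P] invertible. *)
Lemma skolem_noether (K : fieldType) (d : nat)
    (phi : {linear 'M[K]_d.+1 -> 'M[K]_d.+1}) :
  {morph phi : X Y / X *m Y} -> injective phi ->
  exists2 P : 'M[K]_d.+1, P \in unitmx & forall X, phi X = invmx P *m X *m P.
Proof.
move=> phiM phiI.
have [k w_nz] : exists k, row k (phi (delta_mx 0 0)) != 0.
  apply/existsP; rewrite -negb_forall; apply/negP => /forallP all0.
  suff : phi (delta_mx 0 0) = phi 0.
    move/phiI/matrixP/(_ 0 0); rewrite !mxE !eqxx => /eqP.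
    by rewrite oner_eq0.
  by rewrite raddf0; apply/row_matrixP => k; rewrite row0; apply/eqP/all0.
pose P := \matrix_i row k (phi (delta_mx 0 i)).
have PphiE X : P *m phi X = X *m P.
  apply/row_matrixP => i; rewrite !row_mul rowK -[LHS]row_mul -phiM.
  rewrite mulmx_sum_row.
  rewrite [delta_mx 0 i *m X](_ : _ = \sum_j X i j *: delta_mx 0 j).
    rewrite !linear_sum; apply: eq_bigr => j _ /=.
    by rewrite rowK !linearZ mxE.
  apply/matrixP => a b; rewrite mxE (bigD1 i) //= big1 => [|j /negPf ji].
    rewrite summxE (bigD1 b) //= big1 => [|j /negPf jb].
      by rewrite !mxE !eqxx !addr0 !andbT mulrC.
    by rewrite !mxE (eq_sym b) jb andbF mulr0.
  by rewrite !mxE ji andbF mul0r.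
have uP : P \in unitmx.
  (* By [PphiE] the left kernel of [P] is stable under right multiplication. Moving a nonzero entry
     of [u] to position 0 would kill row 0 of [P], which is the nonzero row chosen above. *)
  rewrite -row_free_unit; apply: inj_row_free => u uP0; apply/eqP.
  apply: contraNT w_nz => u_nz.
  have [j uj_nz] : exists j, u 0 j != 0 by apply/rV0Pn.
  have: u *m delta_mx j 0 *m P = 0 by rewrite -mulmxA -PphiE mulmxA uP0 mul0mx.
  rewrite (_ : u *m _ = u 0 j *: delta_mx 0 0); last first.
    apply/rowP => l; rewrite !mxE (bigD1 j) //= big1 => [|a /negPf aj].
      by rewrite !mxE !eqxx addr0.
    by rewrite !mxE aj mulr0.
  rewrite -scalemxAl -rowE rowK => /eqP.
  by rewrite scaler_eq0 (negPf uj_nz).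
by exists P => // X; rewrite -mulmxA -PphiE mulKmx.
Qed.

(** Commuting with [delta_mx j 0] suffices: entry [(i, 0)] of the two products gives [B i j] on one
    side and [B 0 0] or 0 on the other. *)
Lemma central_mx_is_scalar (K : fieldType) (d : nat) (B : 'M[K]_d.+1) :
  (forall X, B *m X = X *m B) -> B = (B 0 0)%:M.
Proof.
move=> BX; apply/matrixP => i j.
have /matrixP/(_ i 0) := BX (delta_mx j 0).
rewrite !mxE (bigD1 j) //= big1 => [|k /negPf kj]; last first.
  by rewrite !mxE kj mulr0.
rewrite (bigD1 0) //= big1 => [|k /negPf k0]; last first.
  by rewrite !mxE k0 andbF mul0r.
rewrite !mxE !eqxx !andbT !addr0 !mulr1 => ->; apply: mulr_natl.
Qed.

(** * Diagonalization of a matrix whose conjugation has finite order *)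

Lemma closed_nth_root (K : closedFieldType) (n : nat) (x : K) :
  (0 < n)%N -> exists y, y ^+ n = x.
Proof.
move=> n_gt0.
have [y] := solve_monicpoly (fun i => if i == 0%N then x else 0) n_gt0.
rewrite -(prednK n_gt0) big_ord_recl expr0 mulr1 big1 => [|i _].
  by rewrite addr0; exists y.
by rewrite mul0r.
Qed.

Lemma closed_char0_natr_neq0 (K : closedFieldType) (n : nat) :
  [pchar K] =i pred0 -> (0 < n)%N -> n%:R != 0 :> K.
Proof.
by move=> charK; rewrite lt0n => n_nz; rewrite ((pcharf0P K).1 charK).
Qed.

(** Dividing [B] by an n-th root of [c] gives a matrix killed by X^n - 1, which splits with distinct
    roots since n is nonzero in [K]. *)
Lemma finite_order_diagonalizable (K : closedFieldType) (d n : nat)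
    (B : 'M[K]_d.+1) (c : K) :
  [pchar K] =i pred0 -> (0 < n)%N -> c != 0 -> B ^+ n = c%:M ->
  exists2 P : 'M[K]_d.+1, P \in unitmx & exists D, P *m B = diag_mx D *m P.
Proof.
move=> charK n_gt0 c_nz Bn.
have [z zn] := closed_nth_root c n_gt0.
have z_nz : z != 0.
  by apply: contraNneq c_nz => z0; rewrite -zn z0 expr0n gtn_eqF.
have [rs rsE] := closed_field_poly_normal ('X^n - 1 : {poly K}).
have: separable_poly ('X^n - 1 : {poly K}).
  exact/separable_Xn_sub_1/closed_char0_natr_neq0.
rewrite {1}rsE (monicP (monicXnsubC 1 n_gt0)) scale1r separable_prod_XsubC.
move=> rs_uniq.
have [P uP PD] : diagonalizable (z^-1 *: B).
  apply/diagonalizableP; exists rs => //.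
  rewrite (monicP (monicXnsubC 1 n_gt0)) scale1r in rsE; rewrite -rsE.
  apply: mxminpoly_min; rewrite rmorphB rmorphXn /= horner_mx_X rmorph1.
  by rewrite exprZn Bn -zn exprVn scale_scalar_mx mulVf ?expf_neq0 // subrr.
have {PD} [D PD] := diagonalizable_forLR uP PD.
rewrite (mxpoly.conjVmx _ uP) in PD.
exists P => //; exists (z *: D).
rewrite linearZ /= -scalemxAl -[LHS]scale1r -(divff z_nz) -scalerA.
by rewrite scalemxAr PD -mulmxA mulKVmx.
Qed.

Lemma eigenvalues_neq0 (K : fieldType) (d : nat) (B P : 'M[K]_d) (D : 'rV_d) :
  B \in unitmx -> P \in unitmx -> P *m B = diag_mx D *m P ->
  forall i, D 0 i != 0.
Proof.
move=> uB uP PB i; have : diag_mx D \in unitmx.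
  by rewrite -(mulmxK uP (diag_mx D)) -PB !unitmx_mul uP uB unitmx_inv.
by rewrite unitmxE det_diag unitfE => /prodf_neq0; apply.
Qed.

(** In the eigenbasis of [B], conjugation by [B] scales each matrix unit separately. *)
Lemma conj_diag_iter (K : fieldType) (d n : nat) (B P : 'M[K]_d) (D : 'rV_d) X :
  B \in unitmx -> P \in unitmx -> P *m B = diag_mx D *m P ->
  forall i j, (P *m iter n (fun X => B *m X *m invmx B) X *m invmx P) i j
    = (D 0 i / D 0 j) ^+ n * (P *m X *m invmx P) i j.
Proof.
move=> uB uP PB i j.
have Dnz := eigenvalues_neq0 uB uP PB.
elim: n => [|n IH]; first by rewrite expr0 mul1r.
rewrite exprS -mulrA -IH /=; set Y := iter n _ X.
have PD : invmx P *m diag_mx D = B *m invmx P.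
  by rewrite -[diag_mx D](mulmxK uP) -PB -mulmxA mulKmx.
have /matrixP/(_ i j) : P *m (B *m Y *m invmx B) *m invmx P *m diag_mx D
    = diag_mx D *m (P *m Y *m invmx P).
  by rewrite -mulmxA PD !mulmxA mulmxKV // PB.
rewrite mul_mx_diag mul_diag_mx !mxE => ZD.
by apply: (mulIf (Dnz j)); rewrite ZD mulrAC divfK.
Qed.

Lemma finite_order_conj_diag (K : closedFieldType) (d n : nat)
    (B : 'M[K]_d.+1) :
  [pchar K] =i pred0 -> (0 < n)%N -> B \in unitmx ->
  (forall X, iter n (fun X => B *m X *m invmx B) X = X) ->
  exists (P : 'M[K]_d.+1) (D : 'rV_d.+1),
    [/\ P \in unitmx, P *m B = diag_mx D *m P, forall i, D 0 i != 0
      & forall i j, (D 0 i / D 0 j) ^+ n = 1].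
Proof.
move=> charK n_gt0 uB Bn.
have uBn : B ^+ n \in unitmx by rewrite -[_ \in _]/(_ \is a GRing.unit) unitrX.
have iterE m X : B ^+ m *m X = iter m (fun X => B *m X *m invmx B) X *m B ^+ m.
  elim: m => [|m IH] /=; first by rewrite mul1mx mulmx1.
  rewrite exprS -mulmxE -mulmxA IH -!mulmxA [invmx B *m _]mulmxA.
  by rewrite mulVmx // mul1mx.
have Bc : B ^+ n = ((B ^+ n) 0 0)%:M.
  by apply: central_mx_is_scalar => X; rewrite iterE Bn.
have c_nz : (B ^+ n) 0 0 != 0.
  apply: contraTneq uBn => c0; rewrite Bc c0 -scalemx1 scale0r.
  by rewrite unitmxE det0 unitr0.
have [P uP [D PB]] := finite_order_diagonalizable charK n_gt0 c_nz Bc.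
exists P, D; split=> // [|i j]; first exact: eigenvalues_neq0 PB.
(* Evaluating at a matrix unit of the eigenbasis isolates the factor [(D 0 i / D 0 j) ^+ n]. *)
have := conj_diag_iter n (invmx P *m delta_mx i j *m P) uB uP PB i j.
rewrite Bn -!mulmxA mulmxV // mulmx1 mulKVmx //.
by rewrite mxE !eqxx mulr1.
Qed.

(** * Congruence normal form of a bilinear form satisfying [A = diag_mx D *m A^T] *)

Lemma antidiag_block_unit (K : fieldType) (a k : nat) (B C : 'M[K]_a)
    (N : 'M[K]_k) :
  B \in unitmx -> C \in unitmx -> N \in unitmx ->
  block_mx 0 (row_mx 0 B) (col_mx 0 C) (block_mx N 0 0 0) \in unitmx.
Proof.
move=> uB uC uN; rewrite -row_free_unit; apply: inj_row_free => v.
rewrite -[v]hsubmxK; move: (lsubmx v) (rsubmx v) => {}v w.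
rewrite -[w]hsubmxK; move: (lsubmx w) (rsubmx w) => {}w x.
rewrite !mul_row_block mul_row_col mul_mx_row !mulmx0 !add0r !addr0 add_row_mx.
rewrite add0r addr0.
move/eqP; rewrite !row_mx_eq0 => /and3P[/eqP xC /eqP wN /eqP vB].
have -> : x = 0 by rewrite -[LHS](mulmxK uC) xC mul0mx.
have -> : w = 0 by rewrite -[LHS](mulmxK uN) wN mul0mx.
have -> : v = 0 by rewrite -[LHS](mulmxK uB) vB mul0mx.
by rewrite !row_mx0.
Qed.

Lemma antiblock_mx_unit (K : fieldType) (m : nat) (M : 'M[K]_m) (s : nat)
    (a : 'I_s -> nat) (lam : 'I_s -> K) (A : forall j, 'M[K]_(a j)) :
  M \in unitmx -> (forall j, lam j != 0) -> (forall j, A j \in unitmx) ->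
  antiblock_mx M lam A \in unitmx.
Proof.
move=> uM; elim: s a lam A => [|s IH] a lam A //= lam_nz uA.
apply: antidiag_block_unit => //; last exact: IH.
by rewrite unitmxZ ?unitfE // unitmx_tr.
Qed.

(** The rows of [Q] span the left orthogonal of the first [m] basis vectors. The relation
    [A = diag_mx D *m A^T] makes it the right orthogonal too, so [A] splits along it although it is
    not symmetric. *)
Lemma schur_complement (K : fieldType) (m n : nat) (A : 'M[K]_(m + n))
    (D : 'rV[K]_(m + n)) :
  A \in unitmx -> A = diag_mx D *m A^T -> ulsubmx A \in unitmx ->
  exists (M : 'M[K]_n) (Q : 'M[K]_(n, m + n)),
    [/\ M \in unitmx, M = diag_mx (rsubmx D) *m M^T,
        Q *m A = row_mx 0 M, A *m Q^T = col_mx 0 M & Q *m A *m Q^T = M].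
Proof.
move=> uA AE uE; set E := ulsubmx A.
pose Q := row_mx (- (dlsubmx A *m invmx E)) 1%:M.
pose M := drsubmx A - dlsubmx A *m invmx E *m ursubmx A.
have QA : Q *m A = row_mx 0 M.
  rewrite -[A]submxK mul_row_block !mulNmx mulmxKV // !mul1mx addNr.
  by rewrite addrC.
have QAQ : Q *m A *m Q^T = M.
  by rewrite QA tr_row_mx mul_row_col mul0mx add0r trmx1 mulmx1.
have AQ : A *m Q^T = col_mx 0 (diag_mx (rsubmx D) *m M^T).
  rewrite AE -mulmxA -trmx_mul QA tr_row_mx -{1}[D]hsubmxK diag_mx_row.
  by rewrite mul_block_col trmx0 !mul0mx mulmx0 !add0r.
have ME : M = diag_mx (rsubmx D) *m M^T.
  by rewrite -{1}QAQ -mulmxA AQ mul_row_col mulmx0 add0r mul1mx.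
exists M, Q; split=> //; last by rewrite AQ -ME.
(* Unipotent row elimination gives det A = det E det M, so [M] is invertible. *)
have : block_mx 1%:M 0 (- (dlsubmx A *m invmx E)) 1%:M *m A
    = block_mx E (ursubmx A) 0 M.
  rewrite /block_mx -/Q mul_col_mx QA -[in LHS]/(col_mx _ _).
  by rewrite -{1}[A]submxK mul_row_block !mul1mx !mul0mx !addr0.
move/(congr1 determinant); rewrite det_mulmx det_lblock !det1 !mul1r det_ublock.
by move: uA; rewrite !unitmxE => + detA; rewrite detA unitrM => /andP[].
Qed.

(* All the blocks [A_j] are taken to be the 1 x 1 identity, so the same [lam_j]
   may occur several times.  The [lam_j] are kept in a sequence because
   [fun j => (l :: ls)`_(lift ord0 j)] is convertible to [fun j => ls`_j],
   as the recursion of [antiblock_mx] requires. *)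
Definition has_antiblock_form (K : fieldType) (m : nat) (A : 'M[K]_m)
    (D : 'rV[K]_m) : Prop :=
  exists (ap am : nat) (Ap : 'M[K]_ap) (Am : 'M[K]_am) (ls : seq K),
  let a := fun _ : 'I_(size ls) => 1%N in
  exists P : 'M[K]_(antiblock_dim (ap + am) a, m),
  [/\ antiblock_dim (ap + am) a = m,
      P *m A *m P^T = antiblock_mx (block_mx Ap 0 0 Am) (fun j => ls`_j)
                        (fun j => 1%:M),
      Ap \in unitmx /\ Ap^T = Ap
    & Am \in unitmx /\ Am^T = - Am] /\
  [/\ forall l, l \in ls -> exists i j,
        [/\ D 0 i = l, D 0 j = l^-1 & l != 0],
      ap != 0%N -> exists i, D 0 i = 1,
      am != 0%N -> exists i, D 0 i = -1
    & ls = [::] -> forall i, D 0 i ^+ 2 = 1].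

(** Reordering the basis is a congruence; this lets a hyperbolic pair be brought to positions 0 and
    1. *)
Lemma has_antiblock_form_perm (K : fieldType) (m : nat) (s : 'S_m)
    (A : 'M[K]_m) (D : 'rV[K]_m) :
  has_antiblock_form (mxsub s s A) (colsub s D) -> has_antiblock_form A D.
Proof.
case=> ap [am [Ap [Am [ls [P [[dimE PA uAp uAm] [lsD apD amD lsN]]]]]]].
exists ap, am, Ap, Am, ls, (P *m perm_mx s); split; split=> //.
- rewrite -PA trmx_mul tr_perm_mx !mulmxA; congr (_ *m _).
  rewrite -!mulmxA; congr (_ *m _).
  by apply/matrixP => i j; rewrite mulmxA -col_permE -row_permE !mxE.
- by move=> l /lsD[i [j]]; rewrite !mxE => ?; exists (s i), (s j).
- by move=> /apD[i]; rewrite mxE; exists (s i).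
- by move=> /amD[i]; rewrite mxE; exists (s i).
by move=> /lsN sq i; have := sq (s^-1%g i); rewrite mxE permKV.
Qed.

Lemma delta_form (K : fieldType) (m : nat) (A : 'M[K]_m) i j :
  (delta_mx 0 i : 'rV_m) *m A *m (delta_mx 0 j : 'rV_m)^T = (A i j)%:M.
Proof.
by rewrite -rowE trmx_delta -colE; apply/matrixP => a b; rewrite !ord1 !mxE.
Qed.

(* The first two basis vectors form a hyperbolic pair; the Schur complement
   describes the form on its orthogonal, and the second vector is rescaled and
   moved to the end. *)
Lemma has_antiblock_form_step (K : fieldType) (n : nat) (A : 'M[K]_(2 + n))
    (D : 'rV[K]_(2 + n)) :
  (forall (A' : 'M[K]_n) (D' : 'rV[K]_n), A' \in unitmx ->
     A' = diag_mx D' *m A'^T -> has_antiblock_form A' D') ->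
  A \in unitmx -> A = diag_mx D *m A^T ->
  A 0 0 = 0 -> A 1 1 = 0 -> A 0 1 = D 0 0 * A 1 0 -> A 1 0 != 0 ->
  D 0 0 * D 0 1 = 1 -> has_antiblock_form A D.
Proof.
move=> IH uA AE A00 A11 A01 A10_nz D01.
have l_nz : D 0 0 != 0 
  by apply/eqP => d0; move/eqP: D01; rewrite d0 mul0r eq_sym oner_eq0.
have e0 : lshift n (0 : 'I_2) = 0 by apply: val_inj.
have e1 : lshift n (1 : 'I_2) = 1 by apply: val_inj.
(* The corner has zero diagonal and antidiagonal entries [D 0 0 * A 1 0] and [A 1 0], both
   nonzero. *)
have uE : ulsubmx A \in unitmx.
  rewrite unitmxE (expand_det_row _ 0) big_ord_recl big_ord1 /cofactor.
  rewrite !det_mx11 !mxE.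
  have -> : lift 0 0 = 1 :> 'I_2 by apply: val_inj.
  have -> : lift 1 0 = 0 :> 'I_2 by apply: val_inj.
  rewrite e0 e1 A00 mul0r add0r unitfE A01.
  by rewrite !mulf_neq0 ?signr_eq0.
have [M [Q [uM ME QA AQ QAQ]]] := schur_complement uA AE uE.
have [ap [am [Ap [Am [ls [P [[dimE PA uAp uAm] [lsD apD amD lsN]]]]]]]] :=
  IH _ _ uM ME.
(* The scaling of [y] makes the pairing of [y] with [x] equal to 1; that of [x] with [y] is then
   [D 0 0], the new lambda. Putting [x] first and [y] last makes the pair the outermost layer. *)
pose x : 'rV[K]_(2 + n) := delta_mx 0 0.
pose y : 'rV[K]_(2 + n) := (A 1 0)^-1 *: delta_mx 0 1.
exists ap, am, Ap, Am, (D 0 0 :: ls), (col_mx x (col_mx (P *m Q) y)).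
split; split=> //=.
- by rewrite dimE addn1.
- rewrite -PA !tr_col_mx trmx1 -QAQ.
  have xA0 : x *m A *m Q^T = 0.
    by rewrite -mulmxA AQ -rowE -e0 rowKu row0.
  have yA0 : y *m A *m Q^T = 0.
    by rewrite -mulmxA AQ -scalemxAl -rowE -e1 rowKu row0 scaler0.
  have Ax0 : Q *m A *m x^T = 0.
    by rewrite QA trmx_delta -colE -e0 colKl col0.
  have Ay0 : Q *m A *m y^T = 0.
    by rewrite QA linearZ /= trmx_delta -scalemxAr -colE -e1 colKl col0 scaler0.
  have yx : y *m A *m x^T = 1%:M.
    by rewrite -!scalemxAl delta_form scale_scalar_mx mulVf.
  have xy : x *m A *m y^T = D 0 0 *: 1%:M.
    rewrite linearZ /= -scalemxAr delta_form A01 !scale_scalar_mx.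
    by rewrite mulrC mulr1 mulfK.
  have xx : x *m A *m x^T = 0 by rewrite delta_form A00 -scalemx1 scale0r.
  have yy : y *m A *m y^T = 0.
    rewrite linearZ /= -scalemxAr -!scalemxAl delta_form A11 -scalemx1.
    by rewrite scale0r !scaler0.
  rewrite mul_col_mx mul_col_row mul_mx_row [col_mx (P *m Q) y *m A]mul_col_mx.
  rewrite mul_col_row mul_col_mx trmx_mul xx xy yx yy !mulmxA xA0 yA0 !mul0mx.
  by rewrite -!(mulmxA P) Ax0 Ay0 !mulmx0.
- move=> l; rewrite inE => /predU1P[->|/lsD[i [j]]]; last first.
    by rewrite !mxE; exists (rshift 2 i), (rshift 2 j).
  by exists 0, 1; split=> //; apply: (mulfI l_nz); rewrite D01 divff.
- by case/apD=> i; rewrite mxE; exists (rshift 2 i).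
by case/amD=> i; rewrite mxE; exists (rshift 2 i).
Qed.
(** Every eigenvalue is 1 or -1, so no pair is split off: the indices are sorted by eigenvalue, and
    the form is symmetric on one part and antisymmetric on the other. *)
Lemma has_antiblock_form_involutive (K : fieldType) (m : nat) (A : 'M[K]_m)
    (D : 'rV[K]_m) :
  2%:R != 0 :> K -> A \in unitmx -> A = diag_mx D *m A^T ->
  (forall i, D 0 i ^+ 2 = 1) -> has_antiblock_form A D.
Proof.
move=> two_nz uA AE D2.
have aE i j : A i j = D 0 i * A j i by rewrite {1}AE mul_diag_mx !mxE.
have neg1 : -1 != 1 :> K by rewrite eq_sym -subr_eq0 opprK.
pose Sp := [set i | D 0 i == 1]; pose Sm := ~: Sp.
have SpP (k : 'I_#|Sp|) : D 0 (enum_val k) = 1.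
  by have := enum_valP k; rewrite inE => /eqP.
have SmP (k : 'I_#|Sm|) : D 0 (enum_val k) = -1.
  have := enum_valP k; rewrite !inE => Dk; have /eqP := D2 (enum_val k).
  by rewrite sqrf_eq1 (negPf Dk) => /eqP.
pose Rp : 'M[K]_(#|Sp|, m) := rowsub enum_val 1%:M.
pose Rm : 'M[K]_(#|Sm|, m) := rowsub enum_val 1%:M.
(* Applying [aE] twice gives [A i j = - A i j], so distinct eigenspaces are orthogonal. *)
have cross (i j : 'I_m) : D 0 i * D 0 j = -1 -> A i j = 0.
  move=> Dij; have : A i j = - A i j.
    by rewrite {1}aE {1}aE mulrA Dij mulN1r.
  move/eqP; rewrite -subr_eq0 opprK -mulr2n -mulr_natl mulf_eq0 (negPf two_nz).
  by move/eqP.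
have subE (X : 'M[K]_m) a b (f : 'I_a -> 'I_m) (g : 'I_b -> 'I_m) :
    rowsub f 1%:M *m X *m (rowsub g 1%:M)^T = mxsub f g X.
  rewrite mul_rowsub_mx mul1mx trmx_mxsub trmx1 mulmx_colsub mulmx1.
  by apply/matrixP => i j; rewrite !mxE.
pose R := col_mx Rp Rm.
have RA : R *m A *m R^T = block_mx (mxsub enum_val enum_val A) 0 0
                                   (mxsub enum_val enum_val A).
  rewrite tr_col_mx mul_col_mx mul_col_row !subE; congr block_mx.
    by apply/matrixP => i j; rewrite !mxE cross // SpP SmP mul1r.
  by apply/matrixP => i j; rewrite !mxE cross // SpP SmP mulr1.
have dimE : (#|Sp| + #|Sm|)%N = m by rewrite cardsC card_ord.
have Rfree : row_free R.
  apply/row_freeP; exists R^T; rewrite tr_col_mx mul_col_row.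
  have orth a b (f : 'I_a -> 'I_m) (g : 'I_b -> 'I_m) :
      rowsub f 1%:M *m (rowsub g 1%:M)^T = mxsub f g 1%:M :> 'M[K]_(a, b).
    by rewrite -[RHS]subE mulmx1.
  rewrite !orth -[RHS]submxK; congr block_mx.
  - by apply/matrixP => i j; rewrite !mxE (inj_eq enum_val_inj) eq_lshift.
  - apply/matrixP => i j; rewrite !mxE eq_lrshift; case: eqP => // ij.
    by have := SmP j; rewrite -ij SpP => /eqP; rewrite eq_sym (negPf neg1).
  - apply/matrixP => i j; rewrite !mxE eq_rlshift; case: eqP => // ij.
    by have := SmP i; rewrite ij SpP => /eqP; rewrite eq_sym (negPf neg1).
  by apply/matrixP => i j; rewrite !mxE (inj_eq enum_val_inj) eq_rshift.
(* The size [#|Sp| + #|Sm|] equals [m] only propositionally, so [R] is a rectangular matrix and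
   invertibility is obtained through ranks. *)
have : R *m A *m R^T \in unitmx.
  have Rrank : \rank R = m by rewrite (eqP Rfree).
  rewrite -row_free_unit -/(row_free _) /row_free mxrankMfree; last first.
    by rewrite /row_free mxrank_tr Rrank.
  by rewrite mxrankMfree ?row_free_unit // Rrank dimE.
rewrite RA block_diag_mx_unit => /andP[uAp uAm].
exists #|Sp|, #|Sm|, (mxsub enum_val enum_val A), (mxsub enum_val enum_val A).
exists [::], R; split; split=> //.
- by split=> //; apply/matrixP => i j; rewrite !mxE aE SpP mul1r.
- by split=> //; apply/matrixP => i j; rewrite !mxE aE SmP mulN1r.
- rewrite -lt0n => p_gt0; exists (enum_val (Ordinal p_gt0)); exact: SpP.
by rewrite -lt0n => p_gt0; exists (enum_val (Ordinal p_gt0)); exact: SmP.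
Qed.

(** Strong induction on the size: an index whose eigenvalue does not square to 1 has a partner
    different from itself, and splitting off the pair lowers the size by 2. *)
Lemma antiblock_form (K : fieldType) (m : nat) (A : 'M[K]_m) (D : 'rV[K]_m) :
  2%:R != 0 :> K -> A \in unitmx -> A = diag_mx D *m A^T ->
  has_antiblock_form A D.
Proof.
move=> two_nz; have [n] := ubnP m; elim: n => // n IH in m A D *.
rewrite ltnS => le_mn uA AE.
have aE i j : A i j = D 0 i * A j i by rewrite {1}AE mul_diag_mx !mxE.
have [/forallP D2|/forallPn[i Di]] := boolP [forall i, D 0 i ^+ 2 == 1].
  by apply: has_antiblock_form_involutive => // i; apply/eqP.
(* An invertible matrix has no zero row. *)
have [j Aij_nz] : exists j, A i j != 0.
  apply/existsP; rewrite -negb_forall; apply/negP => /forallP Ai0.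
  have /rowP/(_ i) : row i (A *m invmx A) = 0.
    rewrite row_mul (_ : row i A = 0) ?mul0mx //.
    by apply/rowP => j; rewrite !mxE; apply/eqP.
  by rewrite mulmxV // !mxE eqxx => /eqP; rewrite oner_eq0.
have Dij : D 0 i * D 0 j = 1.
  by apply: (mulIf Aij_nz); rewrite mul1r -mulrA -aE -aE.
have diag0 k : D 0 k != 1 -> A k k = 0.
  move=> Dk; have /eqP := aE k k; rewrite -subr_eq0 -{1}[A k k]mul1r -mulrBl.
  by rewrite mulf_eq0 subr_eq0 eq_sym (negPf Dk) => /eqP.
have Di1 : D 0 i != 1 by apply: contraNneq Di => ->; rewrite expr1n.
have Dj1 : D 0 j != 1.
  by apply: contra_neq Di1 => Dj; rewrite -Dij Dj mulr1.
have ij : i != j by apply: contraNneq Di => ij; rewrite expr2 {2}ij Dij.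
case: m => [|[|m]] in A D le_mn uA AE aE i j Di Aij_nz Dij diag0 Di1 Dj1 ij *.
- by have := ltn_ord i.
- by rewrite !ord1 in ij.
(* The left factor acts first. It sends 1 to the preimage of [j] under [tperm 0 i] and fixes 0
   because [i != j], so overlaps of [i], [j] with 0, 1 need no case split. *)
pose s : 'S_m.+2 := (tperm 1%R (tperm 0%R i j) * tperm 0%R i)%g.
have s0 : s 0 = i.
  have t0 : tperm 0 i j != 0.
    by rewrite -[X in _ != X](tpermR 0 i) (inj_eq perm_inj) eq_sym.
  by rewrite permM (@tpermD _ 1 _ 0) // tpermL.
have s1 : s 1 = j by rewrite permM tpermL tpermK.
apply: (has_antiblock_form_perm (s := s)).
apply: (@has_antiblock_form_step K m); rewrite ?mxE ?s0 ?s1 //.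
- by move=> A' D'; apply: IH; apply: leq_trans le_mn.
- have -> : mxsub s s A = perm_mx s *m A *m (perm_mx s)^T.
    rewrite tr_perm_mx -col_permE -row_permE.
    by apply/matrixP => a b; rewrite !mxE.
  by rewrite !unitmx_mul unitmx_tr unitmx_perm uA.
- by apply/matrixP => a b; rewrite mul_diag_mx !mxE aE.
- exact: diag0.
- exact: diag0.
by apply: contraNneq Aij_nz => Aji; rewrite aE Aji mulr0.
Qed.

(** * Duality between maps of the coalgebra and maps of the matrix algebra *)

Section Transpose.
Variables (K : fieldType) (d : nat).
Implicit Types (f : 'End(mxcoalg K d)) (X Y A B P : 'M[K]_d).

(* The transpose of [f], acting on ['M[K]_d]. *)
Definition codual f X : 'M[K]_d := \matrix_(i, j) (f (mxcoord K i j) X : K).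

Lemma codualE f (psi : mxcoalg K d) X : f psi X = psi (codual f X).
Proof.
rewrite [psi]mxcoord_span linear_sum !sum_lfunE; apply: eq_bigr => i _.
rewrite linear_sum !sum_lfunE; apply: eq_bigr => j _.
by rewrite linearZ !lfunE /= mxcoordE mxE.
Qed.

Lemma codual_linear f : linear (codual f).
Proof. by move=> a X Y; apply/matrixP => i j; rewrite !mxE linearP. Qed.

Lemma mxcoalg_separates X Y :
  (forall psi : mxcoalg K d, psi X = psi Y) -> X = Y.
Proof. by move=> eqXY; apply/matrixP => i j; rewrite -!mxcoordE. Qed.

Lemma codual_inj f : bijective f -> injective (codual f).
Proof.
case=> g gK fK X Y eqXY; apply: mxcoalg_separates => psi.
by rewrite -[psi]fK !codualE eqXY.
Qed.

Lemma iter_codualE f n (psi : mxcoalg K d) X :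
  iter n f psi X = psi (iter n (codual f) X).
Proof. by elim: n X => //= n IH X; rewrite codualE IH -iterSr. Qed.

Lemma iter_codual_id f n : iter n f =1 id -> iter n (codual f) =1 id.
Proof.
by move=> fn X; apply: mxcoalg_separates => psi; rewrite -iter_codualE fn.
Qed.

Lemma codual_iter_id f n : iter n (codual f) =1 id -> iter n f =1 id.
Proof. by move=> fn psi; apply/lfunP => X; rewrite iter_codualE fn. Qed.

Lemma codual_comp f X : codual (f \o f)%VF X = codual f (codual f X).
Proof.
by apply: mxcoalg_separates => psi; rewrite -codualE comp_lfunE !codualE.
Qed.

Lemma comul_mxcoord i j :
  comul (mxcoord K i j) = \sum_(l < d) mxcoord K i l \ox mxcoord K l j.
Proof.
have [_ + _] := mxcoord_multiplicative K d => /(_ i j); rewrite mxE => ->.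
by apply: eq_bigr => l _; rewrite !mxE.
Qed.

Lemma codualM f : coalg_aut f -> {morph codual f : X Y / X *m Y}.
Proof.
case=> _ fM _ X Y; apply/matrixP => i j.
rewrite !mxE -comulP fM comul_mxcoord.
have ml : linear (tensor_map f f) by exact: tensor_lift_linear.
have el : linear (tensor_eval X Y) by exact: tensor_lift_linear.
rewrite (linear_sum_fun ml) (linear_sum_fun el).
by apply: eq_bigr => l _; rewrite tensor_mapE tensor_evalE !mxE.
Qed.

(** On coordinate functions [comul] is the row-by-column formula, and the swap exchanges the
    arguments [X] and [Y] at which its factors are evaluated. *)
Lemma codual_antiM f : coalg_antiaut f ->
  {morph codual f : X Y / X *m Y >-> Y *m X}.
Proof.
case=> _ fM _ X Y; apply/matrixP => i j.
rewrite !mxE -comulP fM comul_mxcoord.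
have ml : linear (tensor_map f f) by exact: tensor_lift_linear.
have sl : linear (@tensor_swap K (mxcoalg K d) (mxcoalg K d)).
  exact: tensor_lift_linear.
have el : linear (tensor_eval X Y) by exact: tensor_lift_linear.
rewrite (linear_sum_fun ml) (linear_sum_fun sl) (linear_sum_fun el).
apply: eq_bigr => l _; rewrite tensor_mapE tensor_swapE tensor_evalE !mxE.
exact: mulrC.
Qed.

(** For invertible [P], these are the coordinate functions dual to the matrix units
    [invmx P *m delta_mx i j *m P]. *)
Definition conj_coord P : 'M[mxcoalg K d]_d :=
  mx_lrscale P (invmx P) (\matrix_(i, j) mxcoord K i j).

Lemma mx_lrscaleE B C (e : 'M[mxcoalg K d]_d) i j X :
  mx_lrscale B C e i j X = (B *m (\matrix_(k, l) (e k l X : K)) *m C) i j.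
Proof.
rewrite mxE sum_lfunE mxE; under eq_bigr do rewrite sum_lfunE.
rewrite exchange_big; apply: eq_bigr => l _ /=.
rewrite mxE mulr_suml; apply: eq_bigr => k _.
by rewrite lfunE /= mxE; exact: mulrAC.
Qed.

Lemma conj_coordE P i j X : conj_coord P i j X = (P *m X *m invmx P) i j.
Proof.
rewrite mx_lrscaleE; congr ((_ *m _ *m _) _ _).
by apply/matrixP => k l; rewrite !mxE mxcoordE.
Qed.

(** Conjugating back recovers the standard coordinates, so the family spans, and it has d^2 members;
    conjugation preserves products and the identity. *)
Lemma conj_coord_multiplicative P :
  P \in unitmx -> multiplicative_mx (conj_coord P).
Proof.
move=> uP; split=> [|i j|i j].
- rewrite basisEdim; apply/andP; split; last first.
    by rewrite size_map -cardE card_prod card_ord dimvf /dim /= muln1.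
  apply/subvP => phi _; rewrite [phi]mxcoord_span.
  apply: rpred_sum => i _; apply: rpred_sum => j _; apply: rpredZ.
  have -> : mxcoord K i j = \sum_k \sum_l
      (invmx P i k * P l j) *: conj_coord P k l.
    apply/lfunP => X; rewrite mxcoordE.
    transitivity (mx_lrscale (invmx P) P (conj_coord P) i j X).
      rewrite mx_lrscaleE (_ : \matrix_(k, l) _ = P *m X *m invmx P).
        by rewrite -!mulmxA mulKmx // mulVmx // mulmx1.
      by apply/matrixP => k l; rewrite mxE conj_coordE.
    by rewrite mxE.
  apply: rpred_sum => k _; apply: rpred_sum => l _; apply/rpredZ/memv_span.
  by apply/imageP; exists (k, l).
- apply: tensor_eval_inj => x y.
  have el : linear (tensor_eval x y) by exact: tensor_lift_linear.
  rewrite comulP (linear_sum_fun el) conj_coordE.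
  under eq_bigr do rewrite tensor_evalE !conj_coordE.
  have -> : P *m (x *m y) *m invmx P
      = (P *m x *m invmx P) *m (P *m y *m invmx P).
    by rewrite !mulmxA mulmxKV.
  by rewrite mxE.
by rewrite /counit conj_coordE mulmx1 mulmxV // mxE.
Qed.

(** Transposing P X P^-1 gives P^-T X^T P^T; hence [A] changes by congruence, like a bilinear form,
    and not by conjugation. *)
Lemma conj_coord_antiaut f A P :
  A \in unitmx -> P \in unitmx ->
  (forall X, codual f X = A *m X^T *m invmx A) ->
  antiaut_mx f (conj_coord P) (P *m A *m P^T).
Proof.
move=> uA uP fA; split; first by rewrite !unitmx_mul unitmx_tr uP uA.
apply/matrixP => i j; apply/lfunP => X.
rewrite [map_mx _ _ i j]mxE codualE conj_coordE fA mx_lrscaleE.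
rewrite (_ : \matrix_(k, l) _ = (P *m X *m invmx P)^T); last first.
  by apply/matrixP => k l; rewrite [RHS]mxE -conj_coordE [LHS]mxE [_^T _ _]mxE.
congr ((_ : 'M_d) i j).
have u : P *m A *m P^T \in unitmx by rewrite !unitmx_mul unitmx_tr uP uA.
apply: (can_inj (mulmxK u)); rewrite mulmxKV // !mulmxA mulmxKV //.
rewrite mulmxKV // !trmx_mul trmx_inv !mulmxA mulmxK ?unitmx_tr //.
Qed.
End Transpose.

(** * Normal forms of automorphisms and anti-automorphisms *)

Lemma coalg_aut_inner (K : fieldType) (d : nat) (f : 'End(mxcoalg K d.+1)) :
  coalg_aut f -> exists2 B, B \in unitmx &
    forall X, codual f X = B *m X *m invmx B.
Proof.
move=> fA; have [fbij _ _] := fA.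
pose phiL := GRing.isLinear.Build K _ _ *:%R _ (codual_linear f).
pose phi : {linear 'M[K]_d.+1 -> 'M[K]_d.+1} := HB.pack (codual f) phiL.
have [P uP phiE] := @skolem_noether K d phi (codualM fA) (codual_inj fbij).
by exists (invmx P) => [|X]; rewrite ?unitmx_inv // invmxK -phiE.
Qed.

(** Following [codual f] by transposition gives a multiplicative map, to which Skolem-Noether
    applies. *)
Lemma coalg_antiaut_inner (K : fieldType) (d : nat) (f : 'End(mxcoalg K d.+1)) :
  coalg_antiaut f -> exists2 A, A \in unitmx &
    forall X, codual f X = A *m X^T *m invmx A.
Proof.
move=> fA; have [fbij _ _] := fA.
have lin : linear (fun X => (codual f X)^T).
  by move=> a X Y; rewrite codual_linear linearP.
pose phiL := GRing.isLinear.Build K _ _ *:%R _ lin.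
pose phi : {linear 'M[K]_d.+1 -> 'M[K]_d.+1} :=
  HB.pack (fun X => (codual f X)^T) phiL.
have phiM : {morph phi : X Y / X *m Y}.
  by move=> X Y; rewrite /= codual_antiM // trmx_mul.
have phiI : injective phi by move=> X Y /trmx_inj /(codual_inj fbij).
have [P uP phiE] := skolem_noether phiM phiI.
exists P^T => [|X]; rewrite ?unitmx_tr //.
by rewrite -[LHS]trmxK -[(codual f X)^T]/(phi X) phiE !trmx_mul trmx_inv mulmxA.
Qed.

Lemma coalg_antiaut_form (K : closedFieldType) (d n : nat)
    (f : 'End(mxcoalg K d.+1)) :
  [pchar K] =i pred0 -> coalg_antiaut f -> (0 < n)%N ->
  iter n (f \o f)%VF =1 id ->
  exists (A P : 'M[K]_d.+1) (D : 'rV[K]_d.+1),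
  [/\ [/\ A \in unitmx, P \in unitmx & A = diag_mx D *m A^T],
      forall i j, (D 0 i / D 0 j) ^+ n = 1,
      (forall i, D 0 i ^+ 2 = 1) -> iter 2 (f \o f)%VF =1 id
    & forall Q, Q \in unitmx ->
        antiaut_mx f (conj_coord (Q *m P)) (Q *m A *m Q^T)].
Proof.
move=> charK fA n_gt0 fn; have [A uA fE] := coalg_antiaut_inner fA.
pose B := A *m invmx A^T.
have uAt : A^T \in unitmx by rewrite unitmx_tr.
have uB : B \in unitmx by rewrite unitmx_mul uA unitmx_inv.
have ffE X : codual (f \o f)%VF X = B *m X *m invmx B.
  rewrite codual_comp !fE; apply: (can_inj (mulmxK uB)); rewrite mulmxKV //.
  by rewrite !trmx_mul trmxK trmx_inv !mulmxA mulmxKV // mulmxK.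
have iterE m X : iter m (codual (f \o f)%VF) X
    = iter m (fun X => B *m X *m invmx B) X.
  exact: eq_iter.
have [X|P [D [uP PB D_nz Dn]]] := finite_order_conj_diag charK n_gt0 uB.
  by rewrite -iterE iter_codual_id.
exists (P *m A *m P^T), P, D; split=> //.
- split=> //; first by rewrite !unitmx_mul unitmx_tr uP uA.
  (* Both sides agree because [B *m A^T = A]. *)
  rewrite !trmx_mul trmxK !mulmxA -PB; congr (_ *m _).
  by rewrite /B !mulmxA mulmxKV.
- move=> D2; apply: codual_iter_id => X; rewrite iterE.
  have uPi : invmx P \in unitmx by rewrite unitmx_inv.
  apply: (can_inj (mulKmx uP)); apply: (can_inj (mulmxK uPi)).
  apply/matrixP => i j; rewrite (conj_diag_iter _ _ uB uP PB).
  by rewrite expr_div_n !D2 divr1 mul1r.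
move=> Q uQ; rewrite (_ : Q *m _ *m _ = (Q *m P) *m A *m (Q *m P)^T).
  by apply: conj_coord_antiaut; rewrite ?unitmx_mul ?uQ.
by rewrite trmx_mul !mulmxA.
Qed.

Lemma conj_coord_neq0 (K : fieldType) (d : nat) (P : 'M[K]_d) i j :
  P \in unitmx -> conj_coord P i j != 0.
Proof.
move=> uP; apply/eqP => e0.
have := conj_coordE P i j (invmx P *m delta_mx i j *m P).
rewrite e0 lfunE /= -!mulmxA mulmxV // mulmx1 mulKVmx // mxE !eqxx.
by move/eqP; rewrite eq_sym oner_eq0.
Qed.

Lemma coalg_aut_diagonal (K : closedFieldType) (d n : nat)
    (f : 'End(mxcoalg K d.+1)) :
  [pchar K] =i pred0 -> coalg_aut f -> has_order f n ->
  exists (e : 'M[mxcoalg K d.+1]_d.+1) (omega : 'I_d.+1 -> K),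
    [/\ multiplicative_mx e, forall i, omega i != 0,
        forall i j, f (e i j) = (omega i * (omega j)^-1) *: e i j
      & forall i j, n.-unity_root (omega i * (omega j)^-1)].
Proof.
move=> charK fA [n_gt0 fn _]; have [B uB fE] := coalg_aut_inner fA.
have [X|P [D [uP PB D_nz Dn]]] := finite_order_conj_diag charK n_gt0 uB.
  by rewrite -(eq_iter fE) iter_codual_id.
exists (conj_coord P), (D 0); split=> // [|i j|i j].
- exact: conj_coord_multiplicative.
- apply/lfunP => X; rewrite codualE !lfunE /= !conj_coordE fE.
  by rewrite (conj_diag_iter 1 X uB uP PB) expr1.
by apply/unity_rootP.
Qed.

(** Once the sizes are identified, invertibility of [X] forces that of [P]. *)
Lemma congruence_cast (K : fieldType) (d k : nat) (A : 'M[K]_d)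
    (X : 'M[K]_k) (P : 'M[K]_(k, d)) (eq_d : k = d) :
  A \in unitmx -> X \in unitmx -> P *m A *m P^T = X ->
  exists2 Q : 'M[K]_d, Q \in unitmx & Q *m A *m Q^T = castmx (eq_d, eq_d) X.
Proof.
case: d / eq_d A P => A P uA uX PX; exists P => //.
by move: uX; rewrite -PX !unitmx_mul => /andP[/andP[]].
Qed.

(** Quantifying over [eq_d] lets each use supply its own proof of the size equality; quantifying
    over [Q] leaves room for the rescaling when d = 3. *)
Lemma coalg_antiaut_antiblock (K : closedFieldType) (d n : nat)
    (f : 'End(mxcoalg K d.+1)) :
  [pchar K] =i pred0 -> coalg_antiaut f -> (0 < n)%N ->
  iter n (f \o f)%VF =1 id ->
  exists (ap am : nat) (Ap : 'M[K]_ap) (Am : 'M[K]_am) (ls : seq K),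
  let a := fun _ : 'I_(size ls) => 1%N in
  let X := antiblock_mx (block_mx Ap 0 0 Am) (fun j => ls`_j)
             (fun j => 1%:M) in
  [/\ antiblock_dim (ap + am) a = d.+1,
      Ap \in unitmx /\ Ap^T = Ap,
      Am \in unitmx /\ Am^T = - Am
    & forall eq_d : antiblock_dim (ap + am) a = d.+1,
        exists2 P, P \in unitmx & forall Q, Q \in unitmx ->
          antiaut_mx f (conj_coord (Q *m P))
                       (Q *m castmx (eq_d, eq_d) X *m Q^T)] /\
  [/\ forall l, l \in ls -> l != 0,
      forall l l', l \in ls -> l' \in ls ->
        (l / l') ^+ n = 1 /\ (l * l') ^+ n = 1,
      ap != 0%N -> forall l, l \in ls -> l ^+ n = 1,
      am != 0%N -> forall l, l \in ls -> (- l) ^+ n = 1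
    & ls = [::] -> iter 2 (f \o f)%VF =1 id].
Proof.
move=> charK fA n_gt0 fn.
have [A [P [D [[uA uP AE] Dn D2 fE]]]] := coalg_antiaut_form charK fA n_gt0 fn.
have two_nz : 2%:R != 0 :> K by apply: closed_char0_natr_neq0.
have [ap [am [Ap [Am [ls [R]]]]]] := antiblock_form two_nz uA AE.
case=> [[dimE RA uAp uAm] [lsD apD amD lsN]].
have ls_nz l : l \in ls -> l != 0 by case/lsD=> i [j []].
exists ap, am, Ap, Am, ls; split; split=> //.
- move=> eq_d; have uX : antiblock_mx (block_mx Ap 0 0 Am)
      (fun j : 'I_(size ls) => ls`_j) (fun j => 1%:M : 'M_1) \in unitmx.
    apply: antiblock_mx_unit => [|j|j]; last exact: unitmx1.
      by rewrite block_diag_mx_unit; apply/andP; split; [case: uAp|case: uAm].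
    by apply/ls_nz/mem_nth.
  have [Q0 uQ0 Q0A] := congruence_cast eq_d uA uX RA.
  exists (Q0 *m P) => [|Q uQ]; first by rewrite unitmx_mul uQ0.
  rewrite -Q0A (mulmxA Q Q0 P).
  rewrite (_ : Q *m (Q0 *m A *m Q0^T) *m Q^T = (Q *m Q0) *m A *m (Q *m Q0)^T).
    by apply: fE; rewrite unitmx_mul uQ.
  by rewrite trmx_mul !mulmxA.
(* The inverse of [l'] is an eigenvalue as well, so [l * l'] is also a quotient of two eigenvalues.
   Below, dividing by the eigenvalue 1 or -1 gives [l] or [- l]. *)
- move=> l l' /lsD[i [j [<- Dj l_nz]]] /lsD[i' [j' [<- Dj' l'_nz]]].
  by split; first exact: Dn; rewrite -[D 0 i']invrK -Dj' Dn.
- by move=> /apD[k Dk] l /lsD[i [_ [<- _ _]]]; rewrite -(Dn i k) Dk divr1.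
- move=> /amD[k Dk] l /lsD[i [_ [<- _ _]]]; rewrite -(Dn i k) Dk.
  by rewrite invrN1 mulrN1.
by move/lsN/D2.
Qed.

(** * The case d = 3 *)

Lemma ord3_cases (i : 'I_3) : [\/ i = 0, i = 1 | i = 2].
Proof.
by case: i => [[|[|[|//]]] lt_i3]; [apply: Or31|apply: Or32|apply: Or33];
  apply: val_inj.
Qed.

Lemma antiblock3E (K : fieldType) (l : K) (Ap : 'M[K]_1) (Am : 'M[K]_0) :
  (block_mx 0 (row_mx 0 (l *: (1%:M : 'M_1)^T)) (col_mx 0 (1%:M : 'M_1))
    (block_mx (block_mx Ap 0 0 Am) 0 0 0) : 'M_(1 + (1 + 0 + 1)))
  = mx33 [:: [:: 0; 0; l]; [:: 0; Ap 0 0; 0]; [:: 1; 0; 0]] :> 'M_3.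
Proof.
apply/matrixP => i j.
have [->|->|->] := ord3_cases i; have [->|->|->] := ord3_cases j;
  rewrite [RHS]mxE /= !mxE;
  do ?[case: splitP => [[? ?]|[? ?]] /= ?; rewrite ?mxE];
  rewrite ?ord1 ?eqxx ?mulr1 //; lia.
Qed.

Lemma coalg_antiaut_dim3 (K : closedFieldType) (n : nat)
    (f : 'End(mxcoalg K 3)) :
  [pchar K] =i pred0 -> coalg_antiaut f -> has_order (f \o f)%VF n ->
  (2 < n)%N ->
  exists (e : 'M[mxcoalg K 3]_3) (l : K),
    [/\ multiplicative_mx e, l != 0
      & antiaut_mx f e (mx33 [:: [:: 0; 0; l]; [:: 0; 1; 0]; [:: 1; 0; 0]])].
Proof.
move=> charK fA [n_gt0 fn n_min] n_gt2.
have [ap [am [Ap [Am [ls []]]]]] := coalg_antiaut_antiblock charK fA n_gt0 fn.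
case=> [dimE [uAp ApT] [uAm AmT] fE] [ls_nz _ _ _ lsN].
case: ls => [|l [|l' ls]] in dimE fE ls_nz lsN *.
(* Without a hyperbolic pair f^4 would be the identity, against n > 2. *)
- by have := lsN erefl; have := n_min 2%N; rewrite n_gt2 => /(_ isT).
- have l_nz : l != 0 by rewrite ls_nz ?inE.
  have two_nz : 2%:R != 0 :> K by apply: closed_char0_natr_neq0.
  have : (ap + am = 1)%N.
    by have := dimE; rewrite antiblock_dimE sum_nat_const card_ord /=; lia.
  case: ap am => [|[|//]] [|[|//]] //= in Ap Am uAp ApT uAm AmT dimE fE * => _.
    have /matrixP/(_ 0 0) := AmT; rewrite !mxE => /eqP.
    rewrite -subr_eq0 opprK -mulr2n -mulr_natl mulf_eq0 (negPf two_nz).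
    move/eqP=> Am0.
    by move: uAm; rewrite unitmxE det_mx11 Am0 unitr0.
  have Ap_nz : Ap 0 0 != 0 by move: uAp; rewrite unitmxE det_mx11 unitfE.
  have [z z2] := closed_nth_root (Ap 0 0) (isT : 0 < 2)%N.
  have z_nz : z != 0 by apply: contraNneq Ap_nz => z0; rewrite -z2 z0 expr0n.
  have [P uP fP] := fE dimE.
  (* Scaling the middle vector by 1 / z divides the middle entry by z^2 and leaves the hyperbolic
     pair alone. *)
  pose Q : 'M[K]_3 := diag_mx (\row_j (if j == 1 then z^-1 else 1)).
  have uQ : Q \in unitmx.
    rewrite unitmxE det_diag unitfE; apply/prodf_neq0 => i _; rewrite mxE.
    by case: ifP => _; rewrite ?invr_neq0 ?oner_eq0.
  exists (conj_coord (Q *m P)), l; split=> //.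
    by apply: conj_coord_multiplicative; rewrite unitmx_mul uQ.
  have := fP Q uQ; rewrite castmx_id; set X := (X in antiaut_mx _ _ X).
  suff -> : X = mx33 [:: [:: 0; 0; l]; [:: 0; 1; 0]; [:: 1; 0; 0]] by [].
  rewrite /X antiblock3E tr_diag_mx mul_diag_mx; apply/matrixP => i j.
  rewrite mul_mx_diag !mxE.
  have [->|->|->] := ord3_cases i; have [->|->|->] := ord3_cases j => /=;
    rewrite ?mulr1 ?mul1r ?mulr0 ?mul0r //.
  by rewrite -z2 expr2 mulKf // divff.
(* Two pairs already need dimension 4. *)
by have := dimE; rewrite antiblock_dimE sum_nat_const card_ord /=; lia.
Qed.

Lemma antiaut_antidiag3E (K : fieldType) (f : 'End(mxcoalg K 3))
    (e : 'M[mxcoalg K 3]_3) (l : K) : l != 0 ->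
  antiaut_mx f e (mx33 [:: [:: 0; 0; l]; [:: 0; 1; 0]; [:: 1; 0; 0]]) ->
  map_mx f e = mx33 [:: [:: e 2 2; l *: e 1 2; l *: e 0 2];
                        [:: l^-1 *: e 2 1; e 1 1; e 0 1];
                        [:: l^-1 *: e 2 0; e 1 0; e 0 0]].
Proof.
move=> l_nz [uA ->]; set A := mx33 _ in uA *.
pose B : 'M[K]_3 := mx33 [:: [:: 0; 0; 1]; [:: 0; 1; 0]; [:: l^-1; 0; 0]].
have AB : A *m B = 1%:M.
  apply/matrixP => i j; rewrite mxE !big_ord_recl big_ord0.
  have [->|->|->] := ord3_cases i; have [->|->|->] := ord3_cases j;
    by rewrite !mxE /= ?mulr0 ?mul0r ?mulr1 ?add0r ?addr0 ?divff.
have -> : invmx A = B by rewrite -[LHS]mulmx1 -AB mulKmx.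
have o1 : lift ord0 ord0 = 1 :> 'I_3 by apply: val_inj.
have o2 : lift ord0 (lift ord0 ord0) = 2 :> 'I_3 by apply: val_inj.
have o0 : ord0 = 0 :> 'I_3 by apply: val_inj.
apply/matrixP => i j; rewrite !mxE !big_ord_recl !big_ord0 o1 o2 o0.
have [->|->|->] := ord3_cases i; have [->|->|->] := ord3_cases j;
  by rewrite !mxE /= ?(mul0r, mulr0, mulr1, mul1r, scale0r, add0r, addr0)
    ?divff ?scale1r.
Qed.

Lemma antidiag3_square (K : fieldType) (f : 'End(mxcoalg K 3))
    (e : 'M[mxcoalg K 3]_3) (l : K) : l != 0 ->
  map_mx f e = mx33 [:: [:: e 2 2; l *: e 1 2; l *: e 0 2];
                        [:: l^-1 *: e 2 1; e 1 1; e 0 1];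
                        [:: l^-1 *: e 2 0; e 1 0; e 0 0]] ->
  forall i j : 'I_3, f (f (e i j)) = l ^ (j%:Z - i%:Z) *: e i j.
Proof.
move=> l_nz /matrixP fe.
have feE i j := etrans (esym (mxE _ _ i j)) (fe i j).
move=> i j.
have [->|->|->] := ord3_cases i; have [->|->|->] := ord3_cases j;
  rewrite feE [mx33 _ _ _]mxE /= ?linearZ /= feE [mx33 _ _ _]mxE /= ?scalerA;
  rewrite -?invfM;
  (* The second alternative covers the diagonal entries, where no scalar appears. *)
  first [by congr (_ *: _) | by rewrite -[LHS]scale1r; congr (_ *: _)].
Qed.

Theorem proposition2p6 (K : closedFieldType) (charK : [pchar K] =i pred0) :
  (forall (d : nat) (f : 'End(mxcoalg K d)) (n : nat), (0 < d)%N ->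
     coalg_aut f -> has_order f n ->
     exists (e : 'M[mxcoalg K d]_d) (omega : 'I_d -> K),
       [/\ multiplicative_mx e,
           forall i, omega i != 0,
           forall i j, f (e i j) = (omega i * (omega j)^-1) *: e i j
         & forall i j, n.-unity_root (omega i * (omega j)^-1)])
  /\
  (forall (d : nat) (f : 'End(mxcoalg K d)) (n : nat), (0 < d)%N ->
     coalg_antiaut f -> has_order (f \o f)%VF n -> (1 < n)%N ->
     exists (e : 'M[mxcoalg K d]_d) (ap am s : nat) (a : 'I_s -> nat)
            (Ap : 'M[K]_ap) (Am : 'M[K]_am)
            (A : forall j, 'M[K]_(a j)) (lam : 'I_s -> K)
            (Hd : d = (ap + am + 2 * \sum_(j < s) a j)%N),
       [/\ multiplicative_mx e,
           Ap \in unitmx /\ Ap^T = Ap,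
           Am \in unitmx /\ Am^T = - Am,
           forall j, [/\ (0 < a j)%N, A j \in unitmx & lam j != 0]
         & antiaut_mx f e (antiaut_block_mx Hd Ap Am lam A)]
       /\
       [/\ forall i, n.-unity_root (lam i ^+ 2),
           forall i j, n.-unity_root (lam i * (lam j)^-1)
                       /\ n.-unity_root (lam i * lam j),
           ap != 0%N -> forall i, n.-unity_root (lam i)
         & am != 0%N -> forall i, n.-unity_root (- lam i)])
  /\
  (forall (f : 'End(mxcoalg K 3)) (n : nat),
     coalg_antiaut f -> has_order (f \o f)%VF n -> (2 < n)%N ->
     exists (e : 'M[mxcoalg K 3]_3) (lam : K),
       [/\ multiplicative_mx e,
           lam != 0,
           antiaut_mx f e (mx33 [:: [:: 0; 0; lam];
                                    [:: 0; 1; 0];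
                                    [:: 1; 0; 0]]),
           map_mx f e =
             mx33 [:: [:: e 2 2; lam *: e 1 2; lam *: e 0 2];
                      [:: lam^-1 *: e 2 1; e 1 1; e 0 1];
                      [:: lam^-1 *: e 2 0; e 1 0; e 0 0]]
         & forall i j : 'I_3, f (f (e i j)) = lam ^ (j%:Z - i%:Z) *: e i j]).
Proof.
split=> [d f n d_gt0 fA fn|].
  by case: d d_gt0 f fA fn => // d _ f; apply: coalg_aut_diagonal.
split=> [d f n d_gt0 fA [n_gt0 fn _] n_gt1|f n fA fn n_gt2]; last first.
  have [e [l [eM l_nz eA]]] := coalg_antiaut_dim3 charK fA fn n_gt2.
  have fe := antiaut_antidiag3E l_nz eA.
  by exists e, l; split=> //; apply: antidiag3_square.
case: d d_gt0 f fA n_gt0 fn => // d _ f fA n_gt0 fn.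
have [ap [am [Ap [Am [ls []]]]]] := coalg_antiaut_antiblock charK fA n_gt0 fn.
case=> [dimE uAp uAm fE] [ls_nz lsn lsp lsm _].
have Hd : d.+1 = (ap + am + 2 * \sum_(j < size ls) 1)%N.
  by rewrite -dimE antiblock_dimE.
(* This is the very equality proof inside [antiaut_block_mx], so the two casts agree by
   conversion. *)
have [P uP fP] := fE (etrans (antiblock_dimE _ _) (esym Hd)).
have lsP (j : 'I_(size ls)) : ls`_j \in ls by apply: mem_nth.
exists (conj_coord P), ap, am, (size ls), (fun=> 1%N), Ap, Am, (fun=> 1%:M).
exists (fun j => ls`_j), Hd; split; split=> //.
- exact: conj_coord_multiplicative.
- by move=> j; split=> //; [exact: unitmx1|apply: ls_nz].
- by have := fP 1%:M (unitmx1 _ _); rewrite trmx1 mulmx1 !mul1mx.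
- by move=> i; apply/unity_rootP; have [] := lsn _ _ (lsP i) (lsP i).
- move=> i j; have [? ?] := lsn _ _ (lsP i) (lsP j).
  by split; apply/unity_rootP.
- by move=> ap_nz i; apply/unity_rootP/lsp.
by move=> am_nz i; apply/unity_rootP/lsm.
Qed.
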